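(* Under the wavelength restriction, in which a set of logically disjoint $s$-$t$ paths with their mapping on the physical topology is given and each fiber is used by at most $W$ of the given paths, the MSP problem (finding a minimum-cardinality survivable subset of the given paths) can be solved in polynomial time (in the number $m$ of fibers).
   Context: The physical topology is a finite graph $G_P$ whose $m$ links are called fibers, and $s\ne t$ are two of its nodes. A finite set of logically disjoint $s$-$t$ paths (equivalently, parallel logical links between $s$ and $t$) is given, each mapped (routed) onto an $s$-$t$ path in the physical topology; a logical path uses the fibers on its route, and survives a fiber if it does not use it. Wavelength (WDM) restriction: each fiber is used by at most $W$ of the given paths, where $W$ is a fixed constant. A set of given paths is survivable if for every fiber at least one path of the set survives that fiber. *)

(* Defs.v *)
From mathcomp Require Import all_boot all_algebra.

Set Implicit Arguments.
Unset Strict Implicit.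
Unset Printing Implicit Defensive.

(** * Random access machines *)

(* The machine of Cook and Reckhow, "Time bounded random access machines"
   (1973), with natural-number registers and truncated subtraction.  Time is
   the number of executed instructions.  There is deliberately no
   multiplication: in T steps addition alone lengthens the numbers by at most
   T bits, so that this uniform cost is polynomially related to Turing machine
   time. *)
Inductive instr : Type :=
  | IConst of nat & nat         (* IConst r c   : X_r := c *)
  | IAdd of nat & nat & nat     (* IAdd r a b   : X_r := X_a + X_b *)
  | ISub of nat & nat & nat     (* ISub r a b   : X_r := X_a - X_b *)
  | ILoad of nat & nat          (* ILoad r a    : X_r := X_(X_a) *)
  | IStore of nat & nat         (* IStore a r   : X_(X_a) := X_r *)
  | IJpos of nat & nat          (* IJpos r l    : if X_r > 0 then goto l *)
  | IRead of nat                (* IRead r      : X_r := next input number *)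
  | IWrite of nat.              (* IWrite r     : append X_r to the output *)

Definition program := seq instr.

Record config := Config {
  pc : nat;
  regs : nat -> nat;
  input : seq nat;
  output : seq nat
}.

Definition upd (X : nat -> nat) (r v : nat) : nat -> nat :=
  fun i => if i == r then v else X i.

(* Reading past the end of the input yields 0. *)
Definition exec (i : instr) (c : config) : config :=
  let: Config l X inp out := c in
  match i with
  | IConst r v => Config l.+1 (upd X r v) inp out
  | IAdd r a b => Config l.+1 (upd X r (X a + X b)) inp out
  | ISub r a b => Config l.+1 (upd X r (X a - X b)) inp out
  | ILoad r a => Config l.+1 (upd X r (X (X a))) inp out
  | IStore a r => Config l.+1 (upd X (X a) (X r)) inp out
  | IJpos r l' => Config (if 0 < X r then l' else l.+1) X inp out
  | IRead r => Config l.+1 (upd X r (head 0 inp)) (behead inp) out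
  | IWrite r => Config l.+1 X inp (rcons out (X r))
  end.

Definition halted (P : program) (c : config) : bool := size P <= pc c.

(* A halted configuration is a fixed point of [step]. *)
Definition step (P : program) (c : config) : config :=
  if onth P (pc c) is Some i then exec i c else c.

Definition init (w : seq nat) : config := Config 0 (fun=> 0) w [::].

Definition halts_within (P : program) (w : seq nat) (T : nat) (out : seq nat) :
    Prop :=
  let c := iter T (step P) (init w) in halted P c /\ output c = out.

(* One program and one polynomial serve all instances satisfying [dom]; the
   running time is measured against the size parameter [sz]. *)
Definition poly_time_solvable (I : Type) (dom : I -> Prop)
    (encode : I -> seq nat) (sz : I -> nat) (correct : I -> seq nat -> Prop) :
    Prop :=
  exists (P : program) (p : {poly nat}), forall x : I, dom x ->
    exists2 out : seq nat,
      halts_within P (encode x) (p.[sz x])%R out & correct x out.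

(** * Physical topologies and routed logical paths *)

(* A finite undirected graph; the order of the two endpoints of a fiber is
   irrelevant (see [joins]).  Parallel fibers are allowed. *)
Record topology := Topology {
  num_nodes : nat;
  num_fibers : nat;
  ends : 'I_num_fibers -> 'I_num_nodes * 'I_num_nodes
}.

Definition joins (G : topology) (e : 'I_(num_fibers G))
    (uv : 'I_(num_nodes G) * 'I_(num_nodes G)) : bool :=
  (ends e == uv) || (ends e == (uv.2, uv.1)).

(* [p] is the sequence of fibers of a (simple) path from [x] to [y], whose
   nodes are [x :: vs]. *)
Definition is_path (G : topology) (x y : 'I_(num_nodes G))
    (p : seq 'I_(num_fibers G)) : Prop :=
  exists vs : seq 'I_(num_nodes G),
    [/\ all2 (@joins G) p (zip (x :: vs) vs), uniq (x :: vs) & last x vs = y].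

(* The given logical paths are parallel logical links between [src] and [dst],
   indexed by ['I_num_paths]; distinct ones may have the same route. *)
Record instance := Instance {
  topo : topology;
  src : 'I_(num_nodes topo);
  dst : 'I_(num_nodes topo);
  src_neq_dst : src != dst;
  num_paths : nat;
  route : 'I_num_paths -> seq 'I_(num_fibers topo);
  route_path : forall i, is_path src dst (route i)
}.

Definition fibers_of (x : instance) : nat := num_fibers (topo x).

Definition uses (x : instance) (i : 'I_(num_paths x))
    (e : 'I_(num_fibers (topo x))) : bool := e \in route i.

Definition survives (x : instance) (i : 'I_(num_paths x))
    (e : 'I_(num_fibers (topo x))) : bool := ~~ uses i e.

Definition wavelength_restricted (W : nat) (x : instance) : Prop :=
  forall e : 'I_(num_fibers (topo x)),
    #|[set i : 'I_(num_paths x) | uses i e]| <= W.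

Definition survivable (x : instance) (A : {set 'I_(num_paths x)}) : Prop :=
  forall e : 'I_(num_fibers (topo x)), exists2 i, i \in A & survives i e.

Definition min_survivable (x : instance) (A : {set 'I_(num_paths x)}) : Prop :=
  survivable A /\
  forall B : {set 'I_(num_paths x)}, survivable B -> #|A| <= #|B|.

(* A correct answer to the MSP problem is 1 followed by the list of the
   elements of a minimum survivable set, or the single number 0 if no set of
   given paths is survivable. *)
Definition msp_answer (x : instance) (out : seq nat) : Prop :=
  (exists l : seq 'I_(num_paths x),
     [/\ uniq l, min_survivable [set i in l]
       & out = 1 :: [seq val i | i <- l]])
  \/ ((forall A : {set 'I_(num_paths x)}, ~ survivable A) /\ out = [:: 0]).

Definition encode_topology (G : topology) : seq nat :=
  [:: num_nodes G; num_fibers G] ++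
  flatten [seq [:: val (ends e).1; val (ends e).2] | e <- enum 'I_(num_fibers G)].

(* Every variable-length list is preceded by its length. *)
Definition encode (x : instance) : seq nat :=
  encode_topology (topo x) ++
  [:: val (src x); val (dst x); num_paths x] ++
  flatten [seq size (route i) :: [seq val e | e <- route i]
          | i <- enum 'I_(num_paths x)].

(* Main.v *)
Require Import Defs.
From mathcomp Require Import all_boot all_algebra.
From mathcomp Require Import zify.

(** If more than [W] of the given paths are chosen, the chosen set is
    survivable: a fiber is used by at most [W] paths, so one of the chosen
    paths avoids it.  Hence a minimum survivable set has at most [W + 1]
    elements, and if no set of at most [W + 1] paths is survivable then no set
    is ([survivable_of_size]).  Moreover the number [n] of paths is at most
    [W * m]: a route joins two distinct nodes, so it uses at least one of the
    [m] fibers, and the pairs of a path and a fiber that it uses are at most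
    [W * m] ([num_paths_le]).  Since [W] is a constant, trying all sets of at
    most [W + 1] paths takes polynomial time.

    The machine tries tuples instead of sets: for [k = 0, ..., W + 1] in turn,
    all [k]-tuples of path indices, by [k] nested loops whose code is generated
    by recursion on [k].  The first tuple found to be survivable is as short as
    possible; it therefore has no repeated entry, since deleting a duplicate
    would give a shorter survivable tuple, and it lists a minimum survivable
    set ([search_outcome_correct]).  To test a tuple, the input is first
    turned into an [n] by [m] table whose cell [(i, e)] tells whether path [i]
    uses fiber [e]; the table is filled in time [O(n * m)] because a simple
    path has at most as many fibers as there are endpoints of fibers
    ([is_path_size]).

    The machine program is written in a small structured language of code
    fragments, with a weakest-precondition calculus that also bounds the
    number of executed instructions. *)

Set Implicit Arguments.
Unset Strict Implicit.
Unset Printing Implicit Defensive.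

(** * Structured code with a bound on the running time *)

(** A fragment is a function of the address at which it is placed, since jump
    targets are absolute. *)
Definition code := nat -> seq instr.

Definition at_pc (l : nat) (s : config) : config :=
  Config l (regs s) (input s) (output s).

(** Total correctness within [T] steps.  The quantification over the
    surrounding program makes fragments composable.  The program
    counters stored in [s] and [s'] are arbitrary: [at_pc] replaces them by the
    start and the end of the fragment. *)
Definition wp (c : code) (T : nat) (Q : config -> Prop) (s : config) : Prop :=
  forall pre post : program,
    let P := pre ++ c (size pre) ++ post in
    exists t s',
      [/\ t <= T,
          iter t (step P) (at_pc (size pre) s)
          = at_pc (size pre + size (c (size pre))) s'
        & Q s'].

Definition straight (ops : seq instr) : code := fun=> ops.

Definition seqc (c1 c2 : code) : code :=
  fun l => c1 l ++ c2 (l + size (c1 l)).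

(** The conditional jump skips [c] when the register is positive, so that this
    conditional needs neither an unconditional jump nor a scratch register. *)
Definition if_zero (r : nat) (c : code) : code :=
  fun l => IJpos r (l.+1 + size (c l.+1)) :: c l.+1.

(** A do-while loop: [c] is executed at least once. *)
Definition repeat (r : nat) (c : code) : code :=
  fun l => rcons (c l) (IJpos r l).

Declare Scope code_scope.
Delimit Scope code_scope with code.
Notation "c1 ';;' c2" := (seqc c1 c2)
  (at level 60, right associativity) : code_scope.
Local Open Scope code_scope.

(** Executes [c] as many times as the value of register [r], counting [r] down
    to zero.  Register 0 first receives [1 - X_r], which is positive exactly
    when there is nothing to do; afterwards it holds the decrement. *)
Definition loop (r : nat) (c : code) : code :=
  straight [:: IConst 0 1; ISub 0 0 r] ;;
  if_zero 0 (repeat r (c ;; straight [:: IConst 0 1; ISub r r 0])).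

Definition jump_free (i : instr) : bool :=
  if i is IJpos _ _ then false else true.

Definition run_straight (ops : seq instr) (s : config) : config :=
  foldl (fun s i => exec i s) s ops.

Lemma wp_mono c T T' (Q Q' : config -> Prop) s :
  wp c T Q s -> T <= T' -> (forall s', Q s' -> Q' s') -> wp c T' Q' s.
Proof.
move=> wpc leT QQ' pre post.
have [t [s' [le_t run_t Qs']]] := wpc pre post.
by exists t, s'; split; [exact: leq_trans le_t leT | | exact: QQ'].
Qed.

Lemma wp_straight ops Q s :
  all jump_free ops -> Q (run_straight ops s) ->
  wp (straight ops) (size ops) Q s.
Proof.
move=> jf Qs pre post /=; exists (size ops), (run_straight ops s); split=> //.
elim: ops pre s jf {Qs} => [|i ops IH] pre s /=; first by rewrite addn0.
case/andP=> jf_i jf.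
rewrite -iterS iterSr.
have -> : step (pre ++ i :: ops ++ post) (at_pc (size pre) s)
        = at_pc (size pre).+1 (exec i s).
  by rewrite /step /= onth_cat ltnn subnn /=; case: i jf_i; case: s.
have := IH (rcons pre i) (exec i s) jf.
by rewrite size_rcons cat_rcons addSnnS.
Qed.

Lemma wp_seqc c1 c2 T1 T2 Q s :
  wp c1 T1 (wp c2 T2 Q) s -> wp (c1 ;; c2) (T1 + T2) Q s.
Proof.
move=> wp1 pre post.
have [t1 [s1 [le1 run1 wp2]]] :=
  wp1 pre (c2 (size pre + size (c1 (size pre))) ++ post).
have [t2 [s2 [le2 run2 Qs2]]] := wp2 (pre ++ c1 (size pre)) post.
exists (t2 + t1), s2; split=> //; first by rewrite addnC leq_add.
rewrite iterD /seqc -catA run1.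
by rewrite !size_cat -!catA in run2; rewrite run2 size_cat addnA.
Qed.

Lemma wp_if_zero r c T (Q : config -> Prop) s :
  (0 < regs s r -> Q s) -> (regs s r = 0 -> wp c T Q s) ->
  wp (if_zero r c) T.+1 Q s.
Proof.
move=> Qpos Qzero pre post.
set P := pre ++ _.
have step1 : step P (at_pc (size pre) s) =
  at_pc (if 0 < regs s r then (size pre).+1 + size (c (size pre).+1)
         else (size pre).+1) s.
  by rewrite /step /P /= onth_cat ltnn subnn.
have [r0|r_pos] := posnP (regs s r); last first.
  exists 1, s; split=> //; last exact: Qpos.
  by rewrite /= step1 r_pos addnS addSn.
have [t [s' [le_t run_t Qs']]] := Qzero r0 (rcons pre (IJpos r
  ((size pre).+1 + size (c (size pre).+1)))) post.
exists t.+1, s'; split=> //.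
rewrite iterSr step1 r0 /=.
by move: run_t; rewrite size_rcons cat_rcons addnS addSn.
Qed.

Lemma wp_repeat r c T (J : nat -> config -> Prop) N s :
  (forall k s', J k.+1 s' ->
     wp c T (fun s'' => regs s'' r = k /\ J k s'') s') ->
  J N.+1 s -> wp (repeat r c) (N.+1 * T.+1) (J 0) s.
Proof.
move=> body; elim: N s => [|N IH] s /body wps pre post; set P := pre ++ _.
all: have [t [s' [le_t run_t [r_s' Js']]]] := wps pre (IJpos r (size pre) :: post).
all: rewrite -cat_rcons in run_t.
all: have step_jump : step P (at_pc (size pre + size (c (size pre))) s') =
  at_pc (if 0 < regs s' r then size pre
         else size pre + size (repeat r c (size pre))) s'.
1,3: rewrite /step /P /repeat onth_cat ltnNge leq_addr /= addKn cat_rcons.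
1,2: by rewrite onth_cat ltnn subnn /= size_rcons addnS.
- exists t.+1, s'; split=> //; first by rewrite mul1n.
  by rewrite iterS run_t step_jump r_s'.
have [t' [s'' [le_t' run_t' Js'']]] := IH s' Js' pre post.
exists (t' + t.+1), s''; split=> //; first by rewrite mulSn addnC leq_add.
by rewrite iterD iterS run_t step_jump r_s' /= run_t'.
Qed.

(** The invariant [I i] holds after [i] iterations, just before the test.  It
    has to determine the counter, which [c] must therefore leave unchanged. *)
Lemma wp_loop r c T (I : nat -> config -> Prop) N s :
  0 < r -> (forall i s', I i s' -> regs s' r = N - i) ->
  (forall i s', i < N -> I i s' ->
     wp c T (fun s'' => I i.+1 (run_straight [:: IConst 0 1; ISub r r 0] s''))
       s') ->
  regs s r = N -> I 0 (run_straight [:: IConst 0 1; ISub 0 0 r] s) ->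
  wp (loop r c) (3 + N * (T + 3)) (I N) s.
Proof.
move=> r_gt0 Ir body r_s I0; have /= := Ir _ _ I0.
set s0 := run_straight _ s in I0 *; rewrite subn0 => r_s0.
rewrite -[3]/(2 + 1) -addnA; apply: wp_seqc.
apply: (@wp_straight [:: IConst 0 1; ISub 0 0 r]) => //.
rewrite -/s0 add1n.
have s0_0 : regs s0 0 = 1 - N.
  by rewrite /s0 /run_straight -r_s; case: (s) => l X w o; case: (r) r_gt0.
apply: wp_if_zero; rewrite s0_0; first by case: (N) I0.
case: N => [//|N] in Ir body r_s I0 r_s0 s0_0 * => _.
apply: (@wp_mono _ (N.+1 * (T + 2).+1) _
  (fun s' => 0 <= N.+1 /\ I (N.+1 - 0) s')); last 2 first.
- by rewrite !addnS.
- by rewrite subn0 => s' [].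
apply: (@wp_repeat _ _ _ (fun k s' => k <= N.+1 /\ I (N.+1 - k) s'));
  last by rewrite subnn.
move=> k s' [lt_k Is']; apply: wp_seqc.
have lt_N : N.+1 - k.+1 < N.+1 by lia.
apply: wp_mono (body _ _ lt_N Is') _ _ => // s'' Is''.
apply: (@wp_straight [:: IConst 0 1; ISub r r 0]) => //.
have -> : N.+1 - k = (N.+1 - k.+1).+1 by lia.
by split; [rewrite (Ir _ _ Is''); lia | split=> //; exact: ltnW].
Qed.

(** * Reading the instance *)

(** Registers of the program, fixed once and for all:
    - 0 is scratch;
    - 1 and 2 hold the numbers [m] of fibers and [n] of paths;
    - 3 and 4 are loop counters; in a test, 4 is the current fiber;
    - 5 is the address of the table row being filled;
    - 6 is temporary;
    - 7 is positive once an answer has been written;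
    - 8 is positive if the tuple under test is not survivable;
    - [9 + 2 * j] and [10 + 2 * j] belong to the [j]-th nested loop;
    - the table starts at [table_base W], after the registers of the
      [W + 1] loops.

    Rows absent from [rows] count as empty, so that the table of the empty
    list describes memory in its initial state, and a partially read route is
    a partially filled last row. *)
Definition table (K m : nat) (X : nat -> nat) (rows : seq (seq nat)) : Prop :=
  forall i e, e < m -> X (K + i * m + e) = (e \in nth [::] rows i).

Definition skip_fibers : code :=
  straight [:: IRead 0; IRead 1; IAdd 3 1 1] ;;
  loop 3 (straight [:: IRead 0]).

Definition read_route : code :=
  straight [:: IRead 4] ;;
  loop 4 (straight [:: IRead 6; IAdd 6 5 6; IConst 0 1; IStore 6 0]) ;;
  straight [:: IAdd 5 5 1].

Definition read_routes (K : nat) : code :=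
  straight [:: IRead 0; IRead 0; IRead 2; IConst 0 0; IAdd 3 2 0; IConst 5 K] ;;
  loop 3 read_route.

Lemma cell_inj K m i e i' e' : e < m -> e' < m ->
  K + i * m + e = K + i' * m + e' -> (i == i') && (e == e').
Proof.
move=> lt_e lt_e' /eqP; rewrite -!addnA eqn_add2l => /eqP eq_ie.
have m_gt0 : 0 < m by apply: leq_ltn_trans lt_e.
have := congr1 (fun a => a %/ m) eq_ie; have := congr1 (fun a => a %% m) eq_ie.
rewrite /= !modnMDl !divnMDl // !modn_small // !divn_small // !addn0.
by move=> -> ->; rewrite !eqxx.
Qed.

Lemma table_store K m X rows r e : e < m -> table K m X (rcons rows r) ->
  table K m (upd X (K + size rows * m + e) 1) (rcons rows (rcons r e)).
Proof.
move=> lt_e tabX i e' lt_e'; rewrite /upd.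
have := tabX i e' lt_e'.
case: eqP => [eq_cell _|neq]; rewrite !nth_rcons.
  have /andP[/eqP-> /eqP->] := cell_inj lt_e' lt_e eq_cell.
  by rewrite ltnn eqxx mem_rcons inE eqxx.
case: ltngtP => // eq_i ->; rewrite mem_rcons inE.
by case: eqP => // eq_e; case: neq; rewrite eq_i eq_e.
Qed.

(** Opening a new row requires no work: the cells beyond the last row are
    zero already. *)
Lemma table_nil K m X rows : table K m X (rcons rows [::]) <-> table K m X rows.
Proof.
split=> tabX i e /(tabX i e) ->; rewrite nth_rcons; case: ltngtP => // le_i.
- by rewrite nth_default // ltnW.
- by rewrite nth_default // le_i.
- by rewrite nth_default // ltnW.
- by rewrite nth_default // le_i.
Qed.

Lemma table_low K m X r v rows : r < K -> table K m X rows ->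
  table K m (upd X r v) rows.
Proof.
by move=> lt_r tabX i e lt_e; rewrite /upd; case: eqP => [|_]; [lia|exact: tabX].
Qed.

Lemma wp_skip_fibers Q nn m es w :
  size es = m + m ->
  (forall s, regs s 1 = m -> regs s 7 = 0 -> (forall a, 8 < a -> regs s a = 0) ->
     input s = w -> output s = [::] -> Q s) ->
  wp skip_fibers (3 + (3 + (m + m) * (1 + 3))) Q
     (init (nn :: m :: es ++ w)).
Proof.
move=> sz_es HQ; apply: wp_seqc.
apply: (@wp_straight [:: IRead 0; IRead 1; IAdd 3 1 1]) => //.
pose I i s := [/\ regs s 3 = m + m - i, regs s 1 = m, regs s 7 = 0,
  (forall a, 8 < a -> regs s a = 0)
  & input s = drop i es ++ w /\ output s = [::]].
apply: (@wp_mono _ _ _ (I (m + m))).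
- apply: wp_loop => //.
  + by move=> i s [].
  + move=> i [l X inp o] lt_i [/= X3 X1 X7 X9 [-> ->]].
    apply: (@wp_straight [:: IRead 0]) => //; rewrite /I /run_straight /= /upd /=.
    split=> //.
    * by rewrite X3 !subnS subn0.
    * by do 4 case=> //; move=> a; apply: X9.
    * by rewrite (drop_nth 0) // sz_es.
  + rewrite /I /run_straight /= /upd /=; split=> //; first by rewrite subn0.
      by do 4 case=> //.
    by rewrite drop0.
- by [].
- move=> s [_ X1 X7 X9 []]; rewrite -sz_es drop_size; exact: HQ.
Qed.

Lemma wp_read_route Q K m rows r w s L :
  all (fun e => e < m) r -> size r <= L -> 8 < K ->
  regs s 1 = m -> regs s 5 = K + size rows * m -> input s = size r :: r ++ w ->
  table K m (regs s) rows ->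
  (forall s', regs s' 1 = m -> regs s' 2 = regs s 2 -> regs s' 3 = regs s 3 ->
     regs s' 7 = regs s 7 -> output s' = output s ->
     regs s' 5 = K + (size rows).+1 * m -> input s' = w ->
     table K m (regs s') (rcons rows r) -> Q s') ->
  wp read_route (1 + ((3 + L * (4 + 3)) + 1)) Q s.
Proof.
case: s => l0 X0 w0 o0 /= lt_r leL K_gt8 X1 X5 -> tabX HQ; apply: wp_seqc.
apply: (@wp_straight [:: IRead 4]) => //.
apply: wp_seqc.
pose I i s := [/\ regs s 4 = size r - i, regs s 1 = m, regs s 2 = X0 2,
  regs s 3 = X0 3 & [/\ regs s 7 = X0 7, regs s 5 = X0 5,
  input s = drop i r ++ w, output s = o0 &
  table K m (regs s) (rcons rows (take i r))]].
apply: (@wp_mono _ (3 + size r * (4 + 3)) _ (I (size r))).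
- apply: wp_loop => //.
  + by move=> i s [].
  + move=> i [l X inp o] lt_i [/= X_4 X_1 X_2 X_3 [X_7 X_5 -> -> tab]].
    apply: (@wp_straight [:: IRead 6; IAdd 6 5 6; IConst 0 1; IStore 6 0]) => //.
    rewrite (drop_nth 0) //= /I (take_nth 0) // /run_straight /=.
    have lt_e : nth 0 r i < m by apply: (all_nthP 0 lt_r).
    set e := nth 0 r i in lt_e *.
    have a_gt : 8 < X 5 + e by rewrite X_5 X5; lia.
    have low_neq k : k < 9 -> (k == X 5 + e) = false by lia.
    split=> //=; last first; first split=> //=.
    all: try by rewrite /upd /= ?low_neq // X_4 !subnS subn0.
    apply: table_low; first by lia.
    apply: table_low; first by lia.
    (* [X'] is the memory just before the store. *)
    pose X' := upd (upd (upd X 6 e) 6 (X 5 + e)) 0 1.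
    suff: table K m (upd X' (X 5 + e) 1) (rcons rows (rcons (take i r) e)) by [].
    rewrite X_5 X5; apply: table_store => //.
    by do 3 (apply: table_low; first by lia).
  + rewrite /I /run_straight /= /upd /=; split=> //; first by rewrite subn0.
    split=> //; first by rewrite drop0.
    rewrite take0; apply/table_nil.
    by do 3 (apply: table_low; first by lia).
- by rewrite leq_add2l leq_mul2r leL orbT.
case=> l X inp o [/= X_4 X_1 X_2 X_3 [X_7 X_5 -> -> tab]].
apply: (@wp_straight [:: IAdd 5 5 1]) => //; rewrite /run_straight /=.
apply: HQ => //=.
- by rewrite /upd /= X_5 X5 X_1 mulSn; lia.
- by rewrite drop_size.
- by apply: table_low; [lia | move: tab; rewrite take_size].
Qed.

Lemma wp_read_routes Q K m L rs a b w s :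
  8 < K -> all (all (fun e => e < m)) rs -> all (fun r => size r <= L) rs ->
  regs s 1 = m -> regs s 7 = 0 -> (forall a, 8 < a -> regs s a = 0) ->
  input s = [:: a, b, size rs & flatten [seq size r :: r | r <- rs] ++ w] ->
  output s = [::] ->
  (forall s', regs s' 1 = m -> regs s' 2 = size rs -> regs s' 7 = 0 ->
     output s' = [::] -> table K m (regs s') rs -> Q s') ->
  wp (read_routes K) (6 + (3 + size rs * (1 + ((3 + L * (4 + 3)) + 1) + 3))) Q s.
Proof.
case: s => l0 X0 w0 o0 /= K_gt8 lt_rs le_rs X1 X7 X9 -> -> HQ; apply: wp_seqc.
apply: (@wp_straight
  [:: IRead 0; IRead 0; IRead 2; IConst 0 0; IAdd 3 2 0; IConst 5 K]) => //.
pose I i s := [/\ regs s 3 = size rs - i, regs s 1 = m, regs s 2 = size rs,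
  regs s 5 = K + i * m & [/\ regs s 7 = 0, output s = [::],
  input s = flatten [seq size r :: r | r <- drop i rs] ++ w &
  table K m (regs s) (take i rs)]].
apply: (@wp_mono _ _ _ (I (size rs))).
- apply: wp_loop => //.
  + by move=> i s [].
  + move=> i [l X inp o] lt_i [/= X_3 X_1 X_2 X_5 [X_7 -> inpE tab]].
    rewrite (drop_nth [::]) //= -catA in inpE.
    have lt_r := all_nthP [::] lt_rs i lt_i.
    have le_r := all_nthP [::] le_rs i lt_i.
    apply: (@wp_read_route _ K m (take i rs) _ _ (Config l X inp [::]) L
      lt_r le_r K_gt8 _ _ inpE tab) => //=.
      by rewrite X_5 size_takel // ltnW.
    case=> {X_1} l' X' w' o' /= X_1 E2 E3 E7 -> E5 -> tab'.
    rewrite /I /run_straight /=; split=> //=.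
    * by rewrite /upd /= E3 X_3 !subnS subn0.
    * by rewrite /upd /= E2.
    * by rewrite /upd /= E5 size_takel // ltnW.
    split=> //; first by rewrite /upd /= E7.
    rewrite (take_nth [::]) //.
    by do 2 (apply: table_low; first by lia).
  + by rewrite /run_straight /= /upd /= addn0.
  + rewrite /I /run_straight /=; split=> //=.
    * by rewrite /upd /= addn0 subn0.
    * by rewrite /upd /= addn0.
    split=> //; first by rewrite drop0.
    rewrite take0 => i e lt_e.
    by rewrite /upd; do ! (case: eqP => [|_]; first by lia);
      rewrite X9 ?nth_nil //; lia.
- by [].
case=> l X inp o [/= X_3 X_1 X_2 X_5 [X_7 -> inpE tab]].
by apply: HQ => //=; rewrite take_size in tab.
Qed.

(** * Testing a tuple of paths *)

(** [creg j] counts the remaining iterations of the [j]-th nested loop, and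
    [breg j] is the address of the table row of the path that it has reached. *)
Definition creg (j : nat) : nat := 9 + 2 * j.
Definition breg (j : nat) : nat := 10 + 2 * j.
Definition table_base (W : nat) : nat := 11 + 2 * W.

Definition covers_failures (m : nat) (rs : seq (seq nat)) (t : seq nat) : bool :=
  all (fun e => has (fun i => e \notin nth [::] rs i) t) (iota 0 m).

Definition best_tuple (m : nat) (rs : seq (seq nat)) (t : seq nat) : Prop :=
  [/\ all (gtn (size rs)) t, covers_failures m rs t
    & forall u, all (gtn (size rs)) u -> covers_failures m rs u ->
        size t <= size u].

(** The state of the search after the tuples satisfying [R]: an answer has been
    written, which is final, or none of these tuples is survivable. *)
Definition progress (m : nat) (rs : seq (seq nat)) (R : pred (seq nat))
    (s : config) : Prop :=
  (regs s 7 = 1 /\ exists2 t, best_tuple m rs t & output s = 1 :: t) \/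
  [/\ regs s 7 = 0, output s = [::]
    & forall u, all (gtn (size rs)) u -> R u -> ~~ covers_failures m rs u].

(** The entries of [t] are the current values of the outermost [size t] loop
    variables.  A loop counts down, so that its counter holds the number of
    paths minus the loop variable. *)
Definition loaded (W m : nat) (rs : seq (seq nat)) (t : seq nat) (s : config) :
    Prop :=
  [/\ regs s 1 = m, regs s 2 = size rs,
      table (table_base W) m (regs s) rs
    & forall j, j < size t ->
        regs s (creg j) = size rs - nth 0 t j /\
        regs s (breg j) = table_base W + nth 0 t j * m].

Definition same_data (s s' : config) : Prop :=
  [/\ regs s' 1 = regs s 1, regs s' 2 = regs s 2
    & forall a, 8 < a -> regs s' a = regs s a].

Lemma loaded_same W m rs t s s' :
  same_data s s' -> loaded W m rs t s -> loaded W m rs t s'.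
Proof.
move=> [E1 E2 E9] [X1 X2 tab lev]; split; rewrite ?E1 ?E2 //.
  by move=> i e lt_e; rewrite E9 ?tab //; rewrite /table_base; lia.
by move=> j /lev[<- <-]; rewrite !E9 // /creg /breg; lia.
Qed.

Lemma progress_sub m rs (R R' : pred (seq nat)) s s' :
  regs s' 7 = regs s 7 -> output s' = output s ->
  (forall u, all (gtn (size rs)) u -> R' u -> R u) ->
  progress m rs R s -> progress m rs R' s'.
Proof.
move=> E7 Eout subR [[X7 best]|[X7 outE none]]; [left | right].
  by rewrite E7 Eout.
by rewrite E7 Eout; split=> // u lt_u R'u; apply: none; rewrite ?subR.
Qed.

(** Subtracts from register 6 the number of loop variables in [js] whose path
    uses the fiber in register 4. *)
Definition tally (js : seq nat) : seq instr :=
  flatten [seq [:: IAdd 0 (breg j) 4; ILoad 0 0; ISub 6 6 0] | j <- js].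

Lemma run_tally js s : (forall j, j \in js -> 8 < regs s (breg j)) ->
  let s' := run_straight (tally js) s in
  [/\ regs s' 6 =
        regs s 6 - sumn [seq regs s (regs s (breg j) + regs s 4) | j <- js],
      forall a, a != 0 -> a != 6 -> regs s' a = regs s a
    & output s' = output s].
Proof.
elim: js s => [|j js IH] s b_gt; first by rewrite /= subn0.
rewrite /run_straight /tally /= -/(tally js) -/(run_straight _ _).
set s1 := exec _ (exec _ (exec _ s)).
have b_j := b_gt j (mem_head _ _).
have s1E a : a != 0 -> a != 6 -> regs s1 a = regs s a.
  by rewrite /s1; case: (s) => l X w o a0 a6 /=; rewrite /upd !ifN_eq.
have s1_6 : regs s1 6 = regs s 6 - regs s (regs s (breg j) + regs s 4).
  by rewrite /s1; case: (s) b_j => l X w o /= b_j; rewrite /upd /= ifN_eq //; lia.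
have s1_out : output s1 = output s by rewrite /s1; case: (s).
have E4 : regs s1 4 = regs s 4 by rewrite s1E.
have Eb i : i \in js -> regs s1 (breg i) = regs s (breg i) by rewrite s1E.
have [|-> frame ->] := IH s1.
  by move=> i js_i; rewrite Eb // b_gt // inE js_i orbT.
split=> //; last by move=> a a0 a6; rewrite frame ?s1E.
rewrite s1_6 -subnDA E4; congr (_ - (_ + sumn _)).
apply/eq_in_map => i js_i; rewrite Eb // s1E //.
  by have := b_gt i; rewrite inE js_i orbT; lia.
by have := b_gt i; rewrite inE js_i orbT; lia.
Qed.

Definition report (js : seq nat) : seq instr :=
  flatten [seq [:: ISub 0 2 (creg j); IWrite 0] | j <- js].

Lemma run_report js s :
  let s' := run_straight (report js) s in
  (forall a, a != 0 -> regs s' a = regs s a) /\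
  output s' = output s ++ [seq regs s 2 - regs s (creg j) | j <- js].
Proof.
elim: js s => [|j js IH] s; first by rewrite /= cats0.
rewrite /run_straight /report /= -/(report js) -/(run_straight _ _).
set s1 := exec _ (exec _ s).
have s1E a : a != 0 -> regs s1 a = regs s a.
  by rewrite /s1; case: (s) => l X w o a0 /=; rewrite /upd !ifN_eq.
have s1_out : output s1 = rcons (output s) (regs s 2 - regs s (creg j)).
  by rewrite /s1; case: (s).
have [frame ->] := IH s1.
split; first by move=> a a0; rewrite frame ?s1E.
rewrite s1_out cat_rcons; congr (_ ++ _ :: _).
by apply: eq_map => i; rewrite !s1E.
Qed.

(** For each fiber, register 6 starts at [k] and is decreased by the number of
    entries of the tuple whose path uses the fiber: it reaches zero exactly
    when all of them do. *)
Definition test_tuple (k : nat) : code :=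
  straight [:: IConst 8 0; IConst 0 0; IAdd 3 1 0; IConst 4 0] ;;
  loop 3 (straight (IConst 6 k :: tally (iota 0 k)) ;;
          if_zero 6 (straight [:: IConst 8 1]) ;;
          straight [:: IConst 0 1; IAdd 4 4 0]).

Definition test_time (m k : nat) : nat :=
  4 + (3 + m * ((1 + 3 * k) + (2 + 2) + 3)).

Lemma size_flatten_map T1 T2 (f : T1 -> seq T2) c xs :
  (forall x, size (f x) = c) -> size (flatten [seq f x | x <- xs]) = c * size xs.
Proof.
by move=> fc; elim: xs => [|x xs IH]; rewrite ?muln0 //= size_cat fc IH mulnS.
Qed.

Lemma wp_test_tuple Q W m rs t s :
  loaded W m rs t s ->
  (forall s', same_data s s' -> regs s' 7 = regs s 7 ->
     output s' = output s -> (regs s' 8 == 0) = covers_failures m rs t -> Q s') ->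
  wp (test_tuple (size t)) (test_time m (size t)) Q s.
Proof.
move=> ld HQ; apply: wp_seqc.
apply: (@wp_straight [:: IConst 8 0; IConst 0 0; IAdd 3 1 0; IConst 4 0]) => //.
pose survived e := has (fun i => e \notin nth [::] rs i) t.
pose I i s' := [/\ regs s' 3 = m - i, regs s' 4 = i, same_data s s',
  regs s' 7 = regs s 7 /\ output s' = output s
  & (regs s' 8 == 0) = all survived (iota 0 i)].
have next_fiber i s' : regs s' 3 = m - i -> regs s' 4 = i -> same_data s s' ->
    regs s' 7 = regs s 7 /\ output s' = output s ->
    (regs s' 8 == 0) = all survived (iota 0 i) && survived i ->
    wp (straight [:: IConst 0 1; IAdd 4 4 0]) 2
      (fun s'' => I i.+1 (run_straight [:: IConst 0 1; ISub 3 3 0] s'')) s'.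
  have iotaS : iota 0 i.+1 = rcons (iota 0 i) i.
    by rewrite -addn1 iotaD cats1.
  rewrite {}/I iotaS all_rcons andbC.
  case: s' => l X w o /= X3 X4 [/= X1 X2 X9] [X7 ->] X8.
  apply: (@wp_straight [:: IConst 0 1; IAdd 4 4 0]) => //.
  rewrite /= /upd /=; split=> //.
  - by rewrite X3 !subnS subn0.
  - by rewrite X4 addn1.
  by split=> //= a lt_a; rewrite -X9 // !ifN_eq //; lia.
have [X1 _ _ _] := ld.
apply: (@wp_mono _ _ _ (I m)).
- apply: wp_loop => //.
  + by move=> i s' [].
  + move=> i s' lt_i [X3 X4 same [X7 outE] X8].
    have [E1 E2 tab lev] := loaded_same same ld.
    apply: (@wp_mono _ ((1 + 3 * size t) + (2 + 2))); last 2 first.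
    * exact: leqnn.
    * by move=> s''; exact.
    apply: wp_seqc.
    have -> : 1 + 3 * size t = size (IConst 6 (size t) :: tally (iota 0 (size t))).
      by rewrite /= (@size_flatten_map _ _ _ 3) ?size_iota.
    apply: wp_straight.
      by rewrite /=; elim: (iota _ _).
    rewrite /= -/(run_straight _ _); set s1 := exec _ s'.
    have s1E a : a != 6 -> regs s1 a = regs s' a.
      by rewrite /s1; case: (s') => l X w o a6 /=; rewrite /upd ifN_eq.
    have s1_6 : regs s1 6 = size t by rewrite /s1; case: (s').
    have s1_out : output s1 = output s' by rewrite /s1; case: (s').
    have b_gt j : j \in iota 0 (size t) -> 8 < regs s1 (breg j).
      rewrite mem_iota add0n => /lev[_ b_j].
      by rewrite s1E // b_j /table_base; lia.
    have [] := run_tally b_gt; set s2 := run_straight _ _ => s2_6 s2E s2_out.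
    have sumE : sumn [seq regs s1 (regs s1 (breg j) + regs s1 4)
                     | j <- iota 0 (size t)]
              = count (fun j => i \in nth [::] rs j) t.
      rewrite -sumn_count -[in RHS](mkseq_nth 0 t) -map_comp; congr sumn.
      apply/eq_in_map => j; rewrite mem_iota add0n => /lev[_ b_j] /=.
      rewrite !s1E // ?b_j ?X4 ?tab //; by rewrite /table_base; lia.
    have all_use : (regs s2 6 == 0) = all (fun j => i \in nth [::] rs j) t.
      by rewrite s2_6 s1_6 sumE all_count subn_eq0 [in RHS]eqn_leq count_size.
    have someE : survived i = (0 < regs s2 6).
      by rewrite lt0n all_use -has_predC.
    have s2E' a : a != 0 -> a != 6 -> regs s2 a = regs s' a.
      by move=> a0 a6; rewrite s2E // s1E.
    have same2 : same_data s s2.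
      case: same => F1 F2 F9; split; try by rewrite s2E'.
      by move=> a lt_a; rewrite s2E' ?F9 //; lia.
    apply: wp_seqc; apply: wp_if_zero => [pos6|zero6].
    * apply: next_fiber; rewrite ?s2E' // ?s2_out ?s1_out //.
      by rewrite X8 someE pos6 andbT.
    * apply: (@wp_straight [:: IConst 8 1]) => //.
      rewrite zero6 in someE.
      have setE a : a != 8 -> regs (exec (IConst 8 1) s2) a = regs s2 a.
        by case: (s2) => l X w o a8; rewrite /= /upd ifN_eq.
      apply: next_fiber; try by rewrite setE // s2E'.
      - case: same2 => F1 F2 F9; split; rewrite ?setE //.
        by move=> a lt_a; rewrite setE ?F9 //; lia.
      - rewrite setE // s2E' //; split=> //.
        by rewrite -outE -s1_out -s2_out; case: (s2).
      by rewrite someE ltnn andbF; case: (s2).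
  + by case: (s) X1 => l X w o /= X1; rewrite /upd /= X1 addn0.
  + rewrite /I; case: (s) X1 => l X w o /= X1; rewrite /upd /=; split=> //.
      by rewrite addn0 X1 subn0.
    by split=> //= a lt_a; rewrite !ifN_eq //; lia.
- by [].
by move=> s' [_ _ same [E7 Eout] E8]; apply: HQ.
Qed.

(** * The exhaustive search *)

Definition try_tuple (k : nat) : code :=
  if_zero 7 (test_tuple k ;;
    if_zero 8 (straight ([:: IConst 7 1; IWrite 7] ++ report (iota 0 k)))).

(** The loops numbered [j, ..., j + d - 1], around the test of the [k]-tuple;
    [k = j + d]. *)
Fixpoint search (K k j d : nat) : code :=
  if d is d'.+1 then
    straight [:: IConst (breg j) K; IConst 0 0; IAdd (creg j) 2 0] ;;
    loop (creg j) (search K k j.+1 d' ;; straight [:: IAdd (breg j) (breg j) 1])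
  else try_tuple k.

Fixpoint search_time (m n k d : nat) : nat :=
  if d is d'.+1 then 3 + (3 + n * (search_time m n k d' + 1 + 3))
  else 1 + (test_time m k + (1 + (2 + 2 * k))).

Lemma progress_found m rs R s s' : regs s 7 != 0 ->
  regs s' 7 = regs s 7 -> output s' = output s ->
  progress m rs R s -> forall R', progress m rs R' s'.
Proof.
move=> s7 E7 Eout [[X7 best]|[X7 _ _]] R'; last by rewrite X7 in s7.
by left; rewrite E7 Eout.
Qed.

(** All shorter tuples have already failed, so that a tuple passing the test is
    of minimum length. *)
Lemma wp_try_tuple Q W m rs t s (R : pred (seq nat)) :
  all (gtn (size rs)) t -> loaded W m rs t s -> progress m rs R s ->
  (forall u, size u < size t -> R u) ->
  (forall s', loaded W m rs t s' -> progress m rs [predU1 t & R] s' -> Q s') ->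
  wp (try_tuple (size t)) (search_time m (size rs) (size t) 0) Q s.
Proof.
move=> lt_t ld prog smaller HQ; apply: wp_if_zero => [pos7|zero7].
  apply: HQ => //; apply: progress_found prog _ => //; by rewrite -lt0n.
apply: wp_seqc; apply: (wp_test_tuple ld) => s1 same E7 Eout E8.
have ld1 := loaded_same same ld.
have none u : all (gtn (size rs)) u -> R u -> ~~ covers_failures m rs u.
  by case: prog => [[]|[_ _]]; [rewrite zero7 | apply].
have out0 : output s = [::] by case: prog => [[]|[]] //; rewrite zero7.
apply: wp_if_zero => [pos8|zero8].
  apply: HQ => //; right; rewrite E7 zero7 Eout out0; split=> // u lt_u.
  by case/predU1P => [->|]; [rewrite -E8 -lt0n | apply: none].
have cov_t : covers_failures m rs t by rewrite -E8 zero8.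
have -> : 2 + 2 * size t =
    size ([:: IConst 7 1; IWrite 7] ++ report (iota 0 (size t))).
  by rewrite size_cat (@size_flatten_map _ _ _ 2) ?size_iota.
apply: wp_straight; first by rewrite /=; elim: (iota _ _).
rewrite /= -/(run_straight _ _); set s2 := exec _ (exec _ s1).
have s2E a : a != 7 -> regs s2 a = regs s1 a.
  by rewrite /s2; case: (s1) => l X w o a7; rewrite /= /upd ifN_eq.
have [] := run_report (iota 0 (size t)) s2.
set s3 := run_straight _ _ => s3E s3_out.
apply: HQ.
  apply: loaded_same ld1; split; rewrite ?s3E ?s2E // => a lt_a.
  by rewrite s3E ?s2E //; lia.
left; rewrite s3E //; split; first by rewrite /s2; case: (s1).
exists t.
  split=> // u lt_u cov_u; rewrite leqNgt; apply: contraTN cov_u => lt_ut.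
  by apply: none (smaller u lt_ut).
have [_ X2 _ lev] := ld1.
rewrite s3_out s2E // X2.
have -> : output s2 = [:: 1].
  by move: Eout; rewrite out0 /s2; case: (s1) => l X w o /= ->.
congr (_ :: _); rewrite -[RHS](mkseq_nth 0 t); apply/eq_in_map => j.
rewrite mem_iota add0n => lt_j; have [X_c _] := lev j lt_j.
(* The counter [n - t_j] is turned back into the index [t_j]. *)
rewrite s2E /creg ?X_c; last by lia.
by rewrite subKn // ltnW //; apply: (all_nthP 0 lt_t).
Qed.

(** The [d] remaining loops extend the prefix [t] in all possible ways: they
    add to [R] the [k]-tuples that start with [t].  After [i] iterations of the
    outermost of them, the tuples whose entry following [t] is less than [i]
    have been added. *)
Lemma wp_search Q W m rs k d t s (R : pred (seq nat)) :
  size t + d = k -> k <= W.+1 ->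
  all (gtn (size rs)) t -> loaded W m rs t s -> progress m rs R s ->
  (forall u, size u < k -> R u) ->
  (forall s', loaded W m rs t s' ->
     progress m rs
       [pred u | R u || (size u == k) && (take (size t) u == t)] s' -> Q s') ->
  wp (search (table_base W) k (size t) d) (search_time m (size rs) k d) Q s.
Proof.
elim: d t s R Q => [|d IH] t s R Q szt lekW lt_t ld prog smaller HQ.
  rewrite -szt addn0 in smaller HQ *.
  apply: (wp_try_tuple lt_t ld prog smaller) => s' ld' prog'.
  apply: HQ => //; apply: progress_sub prog' => // u _ /orP[Ru|].
    by apply/predU1P; right.
  by case/andP=> /eqP<-; rewrite take_size => /eqP->; apply/predU1P; left.
set j := size t in szt HQ *; set n := size rs.
have lt_jk : j < k by lia.
have lt_cj : creg j < breg j by rewrite /creg /breg; lia.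
have lt_bj : breg j < table_base W by rewrite /breg /table_base; lia.
have gt_c : 8 < creg j by rewrite /creg; lia.
have loaded_upd t' s' s'' : size t' <= j -> loaded W m rs t' s' ->
    (forall a, a != 0 -> a != creg j -> a != breg j -> regs s'' a = regs s' a) ->
    loaded W m rs t' s''.
  move=> le_t' [X1 X2 tab lev] E; split.
  - by rewrite E //; lia.
  - by rewrite E //; lia.
  - by move=> i e lt_e; rewrite E ?tab //; lia.
  - move=> i lt_i; have [<- <-] := lev i lt_i.
    by rewrite !E // /creg /breg; lia.
pose R_ i := [pred u | R u || [&& size u == k, take j u == t & nth 0 u j < i]].
pose I i s' := [/\ regs s' (creg j) = n - i,
  regs s' (breg j) = table_base W + i * m, loaded W m rs t s'
  & progress m rs (R_ i) s'].
rewrite /=; apply: wp_seqc.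
apply: (@wp_straight [:: IConst (breg j) _; IConst 0 0; IAdd (creg j) 2 0]) => //.
set s0 := run_straight _ s.
have s0E a : a != 0 -> a != creg j -> a != breg j -> regs s0 a = regs s a.
  by rewrite /s0; case: (s) => l X w o /= a0 ac ab; rewrite /upd !ifN_eq.
have [_ X2 _ _] := ld.
have s0_c : regs s0 (creg j) = n.
  rewrite /s0; case: (s) X2 => l X w o /= X2; rewrite /upd eqxx /=.
  by rewrite addn0.
have s0_b : regs s0 (breg j) = table_base W.
  by rewrite /s0; case: (s) => l X w o /=; rewrite /upd (gtn_eqF lt_cj) /= eqxx.
have s0_out : output s0 = output s by rewrite /s0; case: (s).
apply: (@wp_mono _ _ _ (I n)).
- apply: wp_loop => //.
  + by move=> i s' [].
  + move=> i s' lt_i [X_c X_b ld' prog'].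
    have szt' : size (rcons t i) = j.+1 by rewrite size_rcons.
    apply: wp_seqc; rewrite -szt'.
    apply: (IH (rcons t i) s' (R_ i)) => //.
    * by rewrite szt' addSnnS.
    * by rewrite all_rcons /= lt_i.
    * have [X1' X2' tab' lev'] := ld'; split=> // i'.
      rewrite szt' ltnS leq_eqVlt nth_rcons => /predU1P[->|lt_i'].
        by rewrite ltnn eqxx.
      by rewrite lt_i'; apply: lev'.
    * by move=> u lt_u; rewrite inE smaller.
    move=> s1 ld1 prog1.
    apply: (@wp_straight [:: IAdd (breg j) (breg j) 1]) => //.
    set s2 := run_straight _ _.
    have s2E a : a != 0 -> a != creg j -> a != breg j -> regs s2 a = regs s1 a.
      by rewrite /s2; case: (s1) => l X w o /= a0 ac ab; rewrite /upd !ifN_eq.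
    have s2_out : output s2 = output s1 by rewrite /s2; case: (s1).
    have [X1 _ _ lev1] := ld1; have [] := lev1 j; first by rewrite szt'.
    rewrite nth_rcons ltnn eqxx => X_c1 X_b1.
    split.
    * rewrite subnS -X_c1 /s2; case: (s1) => l X w o /=; rewrite /upd eqxx /=.
      by rewrite !ifN_eq ?subn1 //; lia.
    * rewrite mulSn addnCA -X_b1 -X1 /s2; case: (s1) => l X w o /=.
      by rewrite /upd (gtn_eqF lt_cj) /= eqxx addnC.
    * apply: loaded_upd s2E => //.
      have [Y1 Y2 tab1 _] := ld1; split=> // i' lt_i'.
      have [] := lev1 i'; first by rewrite szt' ltnW.
      by rewrite nth_rcons lt_i'.
    apply: progress_sub prog1 => //; first by rewrite s2E //; lia.
    move=> u lt_u; rewrite szt' !inE => /orP[->//|].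
    case/and3P=> szu take_u; rewrite ltnS leq_eqVlt => /predU1P[u_j|lt_uj].
      rewrite (take_nth 0) ?(eqP szu) // u_j (eqP take_u) !eqxx.
      by rewrite orbT.
    by rewrite szu take_u lt_uj orbT.
  + set s1 := run_straight _ _.
    have s1E a : a != 0 -> regs s1 a = regs s0 a.
      by rewrite /s1; case: (s0) => l X w o /= a0; rewrite /upd !ifN_eq.
    split.
    * by rewrite s1E ?s0_c ?subn0 //; lia.
    * by rewrite s1E ?s0_b ?mul0n ?addn0 //; lia.
    * by apply: loaded_upd ld _ => // a a0 ac ab; rewrite s1E ?s0E.
    apply: progress_sub prog; first by rewrite s1E ?s0E //; lia.
      by rewrite -s0_out /s1; case: (s0).
    by move=> u _ /orP[//|/and3P[]].
- by [].
move=> s' [_ _ ld' prog']; apply: HQ => //.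
apply: progress_sub prog' => // u lt_u /= /orP[->//|/andP[szu take_u]].
have lt_uj : nth 0 u j < n by apply: (all_nthP 0 lt_u); rewrite (eqP szu).
by rewrite szu take_u lt_uj orbT.
Qed.

Fixpoint search_upto (K k : nat) : code :=
  if k is k'.+1 then search_upto K k' ;; search K k 0 k else search K 0 0 0.

Fixpoint search_upto_time (m n k : nat) : nat :=
  if k is k'.+1 then search_upto_time m n k' + search_time m n k k
  else search_time m n 0 0.

Lemma wp_search_upto Q W m rs k s :
  k <= W.+1 -> loaded W m rs [::] s -> progress m rs pred0 s ->
  (forall s', loaded W m rs [::] s' ->
     progress m rs [pred u | size u <= k] s' -> Q s') ->
  wp (search_upto (table_base W) k) (search_upto_time m (size rs) k) Q s.
Proof.
elim: k Q => [|k IH] Q lekW ld prog HQ.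
  apply: (wp_search (t := [::]) _ _ _ ld prog) => // s' ld' prog'.
  apply: HQ => //; apply: progress_sub prog' => // u _.
  by rewrite !inE leqn0 take0 eqxx => ->.
apply: wp_seqc; apply: IH => //; first exact: ltnW.
move=> s1 ld1 prog1.
apply: (wp_search (t := [::]) _ _ _ ld1 prog1) => // s' ld' prog'.
apply: HQ => //; apply: progress_sub prog' => // u _.
by rewrite !inE take0 eqxx andbT leq_eqVlt ltnS orbC.
Qed.

Definition msp_program (W : nat) : code :=
  skip_fibers ;; read_routes (table_base W) ;;
  search_upto (table_base W) W.+1 ;;
  if_zero 7 (straight [:: IConst 0 0; IWrite 0]).

(** [L] bounds the lengths of the routes. *)
Definition msp_time (W m n L : nat) : nat :=
  (3 + (3 + (m + m) * (1 + 3))) +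
  ((6 + (3 + n * (1 + ((3 + L * (4 + 3)) + 1) + 3))) +
  (search_upto_time m n W.+1 + 3)).

(** What the search establishes about lists of natural numbers: a failure
    excludes only the tuples of at most [W + 1] entries that were tried. *)
Definition search_outcome (W m : nat) (rs : seq (seq nat)) (out : seq nat) :=
  (exists2 t, best_tuple m rs t & out = 1 :: t) \/
  (out = [:: 0] /\ forall u, all (gtn (size rs)) u -> size u <= W.+1 ->
     ~~ covers_failures m rs u).

Lemma wp_msp_program W m L rs nn es a b :
  size es = m + m -> all (all (gtn m)) rs -> all (fun r => size r <= L) rs ->
  wp (msp_program W) (msp_time W m (size rs) L)
    (fun s => search_outcome W m rs (output s))
    (init (nn :: m :: es ++
       [:: a, b, size rs & flatten [seq size r :: r | r <- rs]])).
Proof.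
move=> sz_es lt_rs le_rs; apply: wp_seqc.
apply: wp_skip_fibers => // s1 X1 X7 X9 inpE outE; apply: wp_seqc.
rewrite -[flatten _]cats0 in inpE.
apply: (wp_read_routes _ lt_rs le_rs X1 X7 X9 inpE outE); first by [].
move=> {X1 X7 X9 inpE outE} s2 X1 X2 X7 outE tab; apply: wp_seqc.
apply: wp_search_upto => //; first by right.
move=> s3 _ prog; apply: wp_if_zero => [pos7|zero7].
  by case: prog => [[_ ]|[X7' _ _]]; [left | rewrite X7' in pos7].
apply: (@wp_straight [:: IConst 0 0; IWrite 0]) => //.
case: prog => [[X7' _]|[_ outE' none]]; first by rewrite X7' in zero7.
right; split; first by case: (s3) outE' => l X w o /= ->.
exact: none.
Qed.

(** * The running time is polynomial *)

Lemma search_time_mono m n n' k d :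
  n <= n' -> search_time m n k d <= search_time m n' k d.
Proof.
by move=> le_n; elim: d => //= d IH; rewrite !leq_add2l leq_mul // !leq_add2r.
Qed.

Lemma msp_time_mono W m n n' L : n <= n' -> msp_time W m n L <= msp_time W m n' L.
Proof.
move=> le_n; rewrite /msp_time leq_add2l leq_add //.
  by rewrite !leq_add2l leq_mul.
rewrite leq_add2r.
elim: W.+1 => [|k IH]; first exact: search_time_mono.
by rewrite leq_add // search_time_mono.
Qed.

Definition polynomial_fun (f : nat -> nat) : Prop :=
  exists p : {poly nat}, forall m, f m = (p.[m])%R.

Lemma polynomial_const c : polynomial_fun (fun=> c).
Proof. by exists (c%:P)%R => m; rewrite hornerC. Qed.

Lemma polynomial_id : polynomial_fun id.
Proof. by exists ('X)%R => m; rewrite hornerX. Qed.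

Lemma polynomial_add f g : polynomial_fun f -> polynomial_fun g ->
  polynomial_fun (fun m => f m + g m).
Proof. by case=> p fE [q gE]; exists (p + q)%R => m; rewrite hornerD fE gE. Qed.

Lemma polynomial_mul f g : polynomial_fun f -> polynomial_fun g ->
  polynomial_fun (fun m => f m * g m).
Proof. by case=> p fE [q gE]; exists (p * q)%R => m; rewrite hornerM fE gE. Qed.

Lemma polynomial_search_time W k d :
  polynomial_fun (fun m => search_time m (W * m) k d).
Proof.
elim: d => [|d IH]; rewrite /= /test_time;
  repeat first [exact: polynomial_const | exact: polynomial_id | exact: IH
               | apply: polynomial_mul | apply: polynomial_add].
Qed.

Lemma polynomial_msp_time W :
  polynomial_fun (fun m => msp_time W m (W * m) (m + m)).
Proof.
have search_poly k : polynomial_fun (fun m => search_upto_time m (W * m) k).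
  elim: k => [|k IH]; first exact: polynomial_search_time.
  by apply: polynomial_add => //; apply: polynomial_search_time.
rewrite /msp_time;
  repeat first [exact: polynomial_const | exact: polynomial_id
               | exact: search_poly | apply: polynomial_mul
               | apply: polynomial_add].
Qed.

(** A halted configuration is a fixed point of [step], so that a machine
    running for less than the allowed time has still halted at its end. *)
Lemma halts_within_wp c T Q w T' : wp c T (fun s => Q (output s)) (init w) ->
  T <= T' -> exists2 out, halts_within (c 0) w T' out & Q out.
Proof.
move=> wpc leT; have [t [s' [le_t run_t Qs']]] := wpc [::] [::].
rewrite cats0 /= add0n -/(init w) in run_t.
exists (output s') => //; rewrite /halts_within.
have -> : iter T' (step (c 0)) (init w) = at_pc (size (c 0)) s'.
  rewrite -(subnK (leq_trans le_t leT)) iterD run_t.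
  elim: (T' - t) => //= i ->; rewrite /step /=.
  by rewrite onth_default.
by rewrite /halted /=.
Qed.

(** * Physical routes and the wavelength restriction *)

(** The nodes of the path after [x] are distinct, and each is an endpoint of
    some fiber. *)
Lemma is_path_size (G : topology) (x y : 'I_(num_nodes G)) p :
  is_path x y p -> size p <= num_fibers G + num_fibers G.
Proof.
case=> vs [joined /= /andP[_ uniq_vs] _].
have size_p : size p = size vs.
  move: joined; rewrite all2E => /andP[/eqP-> _].
  by rewrite size_zip /=; apply/minn_idPr.
set nodes := [seq (ends e).1 | e : 'I_(num_fibers G)] ++
             [seq (ends e).2 | e : 'I_(num_fibers G)].
have -> : num_fibers G + num_fibers G = size nodes.
  by rewrite size_cat !size_image card_ord.
rewrite size_p; apply: uniq_leq_size uniq_vs _.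
elim: p x vs joined {size_p} => [|e p IH] x [|v vs] //= /andP[join_e joined].
move=> z; rewrite inE => /predU1P[->|]; last exact: IH joined z.
rewrite mem_cat; case/orP: join_e => /eqP e_ends; apply/orP; [right|left].
  by apply/imageP; exists e; rewrite ?e_ends.
by apply/imageP; exists e; rewrite ?e_ends.
Qed.

Lemma route_not_nil (x : instance) (i : 'I_(num_paths x)) : route i != [::].
Proof.
apply/eqP => route0; have [vs []] := route_path i; rewrite route0.
by case: vs => //= _ _ src_dst; move: (src_neq_dst x); rewrite src_dst eqxx.
Qed.

(** Double counting of the pairs of a path and a fiber that it uses. *)
Lemma num_paths_le W (x : instance) :
  wavelength_restricted W x -> num_paths x <= W * fibers_of x.
Proof.
move=> restricted; rewrite -{1}(card_ord (num_paths x)) -sum1_card.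
apply: (@leq_trans (\sum_(i : 'I_(num_paths x)) \sum_e uses i e)).
  apply: leq_sum => i _; move: (route_not_nil i).
  case route_i: (route i) => [//|e p] _.
  by rewrite (bigD1 e) //= /uses route_i mem_head.
rewrite exchange_big /= mulnC -[fibers_of x]card_ord -sum_nat_const.
apply: leq_sum => e _; apply: leq_trans (restricted e).
rewrite -sum1_card [leqRHS]big_mkcond /=.
by apply: leq_sum => i _; rewrite inE; case: uses.
Qed.

Definition routes_of (x : instance) : seq (seq nat) :=
  [seq [seq val e | e <- route i] | i <- enum 'I_(num_paths x)].

Lemma size_routes_of x : size (routes_of x) = num_paths x.
Proof. by rewrite size_map size_enum_ord. Qed.

Lemma covers_failuresP (x : instance) (l : seq 'I_(num_paths x)) :
  reflect (survivable [set i in l])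
    (covers_failures (fibers_of x) (routes_of x) (map val l)).
Proof.
have rowE (i : 'I_(num_paths x)) (e : 'I_(fibers_of x)) :
    (val e \notin nth [::] (routes_of x) (val i)) = survives i e.
  rewrite (nth_map i) ?size_enum_ord ?ltn_ord // nth_ord_enum mem_map //.
  exact: val_inj.
apply: (iffP allP) => [cov e | surv e].
  have /cov/hasP[_ /mapP[i l_i ->]] : val e \in iota 0 (fibers_of x).
    by rewrite mem_iota add0n ltn_ord.
  by rewrite rowE => surv; exists i; rewrite ?inE.
rewrite mem_iota add0n => /= lt_e.
have [i] := surv (Ordinal lt_e); rewrite inE -rowE => l_i surv_i.
by apply/hasP; exists (val i); rewrite ?map_f.
Qed.

Lemma lift_ordinals n (u : seq nat) :
  all (gtn n) u -> exists l : seq 'I_n, u = map val l.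
Proof.
elim: u => [|i u IH] /=; first by exists [::].
by case/andP=> lt_i /IH[l ->]; exists (Ordinal lt_i :: l).
Qed.

Lemma all_val n (l : seq 'I_n) : all (gtn n) (map val l).
Proof. by apply/allP => _ /mapP[i _ ->] /=. Qed.

Lemma set_of_enum (T : finType) (A : {set T}) : [set i in enum A] = A.
Proof. by apply/setP => i; rewrite inE mem_enum. Qed.

(** This is where the wavelength restriction bounds the search: a fiber used
    by all paths of [l] would be used by more than [W] paths. *)
Lemma survivable_of_size W (x : instance) (l : seq 'I_(num_paths x)) :
  wavelength_restricted W x -> uniq l -> W < size l -> survivable [set i in l].
Proof.
move=> restricted uniq_l lt_l e.
have [/allP all_use|] := boolP (all (fun i => uses i e) l); last first.
  by case/allPn => i l_i surv; exists i; rewrite ?inE.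
have le_l : size l <= #|[set i | uses i e]|.
  rewrite -(card_uniqP uniq_l).
  by apply/subset_leq_card/subsetP => i /all_use; rewrite inE.
by have := leq_trans lt_l (leq_trans le_l (restricted e)); rewrite ltnn.
Qed.

(** A list of paths of minimum length among the survivable ones has no
    duplicates.  If the search fails, it suffices to find, in any survivable
    set, a survivable list of at most [W + 1] paths: the first [W + 1] elements
    of the set, or all of them if there are fewer. *)
Lemma search_outcome_correct W (x : instance) out :
  wavelength_restricted W x ->
  search_outcome W (fibers_of x) (routes_of x) out -> msp_answer x out.
Proof.
move=> restricted [[t [lt_t cov_t best] ->]|[-> none]]; last first.
  right; split=> // A surv_A.
  pose l := take W.+1 (enum A).
  have le_l : size (map val l) <= W.+1 by rewrite size_map size_take_min geq_minl.
  have lt_l : all (gtn (size (routes_of x))) (map val l).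
    by rewrite size_routes_of all_val.
  have /covers_failuresP[] := none _ lt_l le_l.
  have [lt_A|le_A] := ltnP W (size (enum A)).
    apply: (survivable_of_size restricted); first by rewrite take_uniq ?enum_uniq.
    by rewrite size_takel.
  by rewrite /l take_oversize ?set_of_enum // ltnW.
rewrite size_routes_of in lt_t best.
have [l tE] := lift_ordinals lt_t; rewrite {t lt_t}tE in cov_t best *.
move/covers_failuresP: cov_t => surv_l; rewrite size_map in best.
have uniq_l : uniq l.
  apply: contraT; rewrite -ltn_size_undup ltnNge => /negP[].
  rewrite -(size_map val (undup l)); apply: best (all_val _) _.
  apply/covers_failuresP; have -> // : [set i in undup l] = [set i in l].
  by apply/setP => i; rewrite !inE mem_undup.
left; exists l; split=> //; split=> // B surv_B.
rewrite cardsE (card_uniqP uniq_l) cardE -(size_map val (enum B)).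
by apply: best (all_val _) _; apply/covers_failuresP; rewrite set_of_enum.
Qed.

Theorem theorem5 (W : nat) :
  poly_time_solvable (wavelength_restricted W) encode fibers_of msp_answer.
Proof.
have [p timeE] := polynomial_msp_time W.
exists (msp_program W 0), p => x restricted; rewrite -timeE.
set m := fibers_of x.
have [] := @halts_within_wp (msp_program W)
    (msp_time W m (size (routes_of x)) (m + m))
    (search_outcome W m (routes_of x)) (encode x) (msp_time W m (W * m) (m + m)).
- have -> : encode x = num_nodes (topo x) :: m ::
     flatten [seq [:: val (ends e).1; val (ends e).2]
             | e <- enum 'I_(num_fibers (topo x))] ++
     [:: val (src x), val (dst x), size (routes_of x)
       & flatten [seq size r :: r | r <- routes_of x]].
    rewrite size_routes_of /encode /= /routes_of -map_comp.
    congr (_ :: _ :: _ ++ [:: _, _, _ & flatten _]).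
    by apply: eq_map => i /=; rewrite size_map.
  apply: wp_msp_program.
  + by rewrite (@size_flatten_map _ _ _ 2) // size_enum_ord mul2n addnn.
  + by apply/allP => _ /mapP[i _ ->]; apply: all_val.
  + apply/allP => _ /mapP[i _ ->]; rewrite size_map.
    exact: is_path_size (route_path i).
- by apply: msp_time_mono; rewrite size_routes_of num_paths_le.
by move=> out halts ans; exists out => //; apply: search_outcome_correct ans.
Qed.
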